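(* Let $K$ be a field of characteristic zero and let $n\ge1$, $d\ge0$ be integers. The $K$-vector space of balancings over $K$ on the complete nonsingular $d$-complex on $n$ vertices $\Delta^{ns}_{n,d}$ has dimension $\max\left\{\binom{n}{d+1}-\binom{n}{d},\,0\right\}$.
   Context: The complete nonsingular $d$-complex on $n$ vertices $\Delta^{ns}_{n,d}$ is the set of all nonsingular $d$-simplices on $\{1,\ldots,n\}$, i.e. all subsets of $\{1,\ldots,n\}$ of cardinality $d+1$. $m(i\in S)$ is the multiplicity of $i$ in a multiset $S$, and $m(T\subseteq S)=\prod_{i}\binom{m(i\in S)}{m(i\in T)}$ (zero if $T\not\subseteq S$). A balancing over $K$ on a $d$-complex $\Delta$ (a set of multisets of cardinality $d+1$ on $\{1,\ldots,n\}$) is a function $w:\Delta\to K$ (zero values allowed) such that $\sum_{S\subseteq\sigma\in\Delta}w(\sigma)\,m(S\subseteq\sigma)=0$ for every multiset $S$ on $\{1,\ldots,n\}$ with $0\le|S|\le d$. *)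

(* Defs.v *)
From HB Require Import structures.
From mathcomp Require Import all_boot all_order all_algebra.
From mathcomp Require Import finmap multiset.

Set Implicit Arguments.
Unset Strict Implicit.
Unset Printing Implicit Defensive.
Import Order.TTheory GRing.Theory Num.Theory.

Local Open Scope fset_scope.
Local Open Scope mset_scope.
Local Open Scope nat_scope.

(* The vertex set {1, ..., n} is encoded by 'I_n.  The cardinality of a       *)
(* multiset counts repetitions: it is [size S], whereas #|S| would be the     *)
(* number of distinct elements of S.                                          *)

Definition dcomplex (n d : nat) (Delta : {fset {mset 'I_n}}) : Prop :=
  forall s : {mset 'I_n}, s \in Delta -> size s = d.+1.

(* The multiplicity m(T <= S); a factor vanishes as soon as T i > S i.        *)
Definition mset_mult (n : nat) (T S : {mset 'I_n}) : nat :=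
  \prod_(i < n) 'C(S i, T i).

Lemma mset_mult_eq0 (n : nat) (T S : {mset 'I_n}) :
  ~~ (T `<=` S) -> mset_mult T S = 0.
Proof.
move=> nTS; apply/eqP; apply: contraR nTS; rewrite -lt0n => m0.
apply/msubsetP => i; rewrite -bin_gt0.
by move: m0; rewrite /mset_mult (bigD1 i) //= muln_gt0 => /andP[].
Qed.

(* K^o is K seen as a vector space over itself, so that the functions         *)
(* Delta -> K form the vector space {ffun Delta -> K^o}.                      *)
Definition balancing (K : fieldType) (n d : nat) (Delta : {fset {mset 'I_n}})
    (w : {ffun Delta -> K^o}) : Prop :=
  forall S : {mset 'I_n}, size S <= d ->
    (\sum_(s : Delta | S `<=` val s) w s * (mset_mult S (val s))%:R = 0 :> K)%R.

Definition complete_ns (n d : nat) : {fset {mset 'I_n}} :=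
  [fset seq_mset (enum A) | A : {set 'I_n} in [pred A : {set 'I_n} | #|A| == d.+1]].

Lemma complete_nsP (n d : nat) (s : {mset 'I_n}) :
  reflect (size s = d.+1 /\ forall i, s i <= 1) (s \in complete_ns n d).
Proof.
apply: (iffP idP) => [/imfsetP[/= A] | [sz s1]].
  move=> /eqP cA ->; split=> [|i].
    by rewrite (perm_size (perm_eq_seq_mset _)) -cardE.
  by rewrite mset_seqE count_uniq_mem ?enum_uniq // leq_b1.
have us : uniq s.
  apply/count_mem_uniq => i; rewrite count_mem_mset -mset_neq0.
  by case: (s i) (s1 i) => [|[]].
apply/imfsetP; exists [set i in s] => /=.
  by apply/eqP; rewrite -sz -(card_uniqP us); apply: eq_card => i; rewrite inE.
apply/msetP => i.
rewrite mset_seqE count_uniq_mem ?enum_uniq // mem_enum inE -mset_neq0.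
by case: (s i) (s1 i) => [|[]].
Qed.

Lemma complete_ns_dcomplex (n d : nat) : dcomplex d (complete_ns n d).
Proof. by move=> s /complete_nsP[]. Qed.

(* Main.v *)
Require Import Defs.
From HB Require Import structures.
From mathcomp Require Import all_boot all_order all_algebra.
From mathcomp Require Import finmap multiset.
Import Order.TTheory GRing.Theory Num.Theory.
Local Open Scope ring_scope.

(** The balancing condition for a multiset S that is not contained in any
    nonsingular simplex is an empty sum, and all multiplicities below a
    nonsingular simplex are 1.  So a balancing is a function on (d+1)-subsets
    whose sum over the (d+1)-supersets of each set of size at most d vanishes.
    The conditions at size d suffice: summing over the one-point extensions of
    A the sums over supersets counts every superset of A of size d+1 exactly
    d+1-|A| times, and d+1-|A| is invertible in characteristic zero
    ([shadow_eq0]).  The balancings thus form the kernel of the map [down] from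
    functions on (d+1)-subsets to functions on d-subsets, and the theorem says
    that this map has full rank.

    Let [up] be the transpose of [down].  On functions on k-subsets of an
    n-set, [down up - up down] is the scalar n - 2k ([down_up_comm]).  Hence
    [up down] cannot have a negative integer eigenvalue when 2k <= n: if
    [up down f = - c f], then [up down (down f) = - (c + n - 2k + 2) (down f)],
    so [down f] vanishes by induction on k, and then so does [f]
    ([up_down_neg_eigen]).  Over an ordered field this is positivity of
    [up down]; the induction makes it available over any field of
    characteristic zero.  If 2k < n, the kernel of [down up] on k-subsets would
    consist of eigenvectors of [up down] of eigenvalue -(n - 2k), so [down up]
    is injective ([down_up_inj]).

    If 2d < n, injectivity of [down up] on functions on d-subsets makes [down]
    surjective, and the kernel has dimension C(n,d+1) - C(n,d).  Otherwise
    2(d+1) > n, and complementation of subsets, which exchanges [up] and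
    [down], turns the same lemma into injectivity of [down] ([down_inj]); the
    kernel is zero.  In both cases the comparison of the two binomial
    coefficients is read off from the rank.  *)

(** * The up and down operators on the Boolean lattice *)

Section Boolean.

Set Implicit Arguments.
Unset Strict Implicit.

Variables (K : fieldType) (T : finType).
Implicit Types (f g : {set T} -> K) (A B : {set T}) (i : T).

Definition up f A : K := \sum_(i in A) f (A :\ i).
Definition down f A : K := \sum_(i | i \notin A) f (i |: A).

Lemma eq_down f g A : (forall B, #|B| = #|A|.+1 -> f B = g B) ->
  down f A = down g A.
Proof. by move=> fg; apply: eq_bigr => i iA; apply: fg; rewrite cardsU1 iA. Qed.

Lemma downZ (c : K) f A : down (fun B => c * f B) A = c * down f A.
Proof. by rewrite /down -mulr_sumr. Qed.

(** Adding a point and then removing one, or the other way round, leads to the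
    same exchanges of a point of A with a point outside; the two orders differ
    only in the number of ways to return to A, which is the size of the
    complement of A in the first case and of A in the second.  *)
Lemma down_up_comm f A :
  down (up f) A + #|A|%:R * f A = up (down f) A + #|~: A|%:R * f A.
Proof.
have dE : down (up f) A =
    #|~: A|%:R * f A
    + \sum_(i | i \notin A) \sum_(j in A) f (i |: A :\ j).
  rewrite mulr_natl -sumr_const (eq_bigl [pred i | i \notin A]); last first.
    by move=> i; rewrite /= inE.
  rewrite /= -big_split /=; apply: eq_bigr => i iA.
  rewrite /up big_setU1 //= setU1K //; congr (_ + _).
  apply: eq_bigr => j jA; congr (f _).
  apply/setP => x; rewrite !inE.
  by case: (x =P i) => [->|] //=; case: (i =P j) iA => [->|]; rewrite ?jA.
have uE : up (down f) A =
    #|A|%:R * f A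
    + \sum_(j in A) \sum_(i | i \notin A) f (i |: A :\ j).
  rewrite mulr_natl -sumr_const -big_split /=.
  apply: eq_bigr => j jA; rewrite /down.
  rewrite (bigD1 j) /=; last by rewrite !inE eqxx.
  rewrite setD1K //; congr (_ + _); apply: eq_bigl => i.
  by rewrite !inE; case: (i =P j) => [->|]; rewrite ?jA ?andbF ?andbT.
rewrite dE uE exchange_big /= -!addrA [X in _ + X]addrC addrCA.
by congr (_ + _); rewrite addrC.
Qed.

Lemma cardC_layer k A : (k.*2 <= #|T|)%N -> #|A| = k ->
  #|~: A| = (k + (#|T| - k.*2))%N.
Proof.
move=> kT cA; apply: (@addnI k).
by rewrite -{1}cA cardsC addnA addnn subnKC.
Qed.

Hypothesis charK : [pchar K] =i pred0.

Lemma mul_natrS_eq0 n (x : K) : n.+1%:R * x = 0 -> x = 0.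
Proof.
by move/eqP; rewrite mulf_eq0 (pcharf0P K).1 // => /eqP.
Qed.

(** A semidefiniteness argument without an order on the field: applying [down]
    to the eigenvalue equation gives one for [down f] one level lower, with a
    still more negative eigenvalue, and at the empty set [up] is zero.  The
    eigenvalue is kept as the opposite of a positive integer, which is what
    characteristic zero makes invertible.  *)
Lemma up_down_neg_eigen k c f : (k.*2 <= #|T|)%N ->
    (forall A, #|A| = k -> up (down f) A = - c.+1%:R * f A) ->
  forall A, #|A| = k -> f A = 0.
Proof.
elim: k c f => [|k IH] c f kT eig A cA.
  apply: (@mul_natrS_eq0 c); apply/eqP; rewrite -oppr_eq0 -mulNr -eig //.
  by move/cards0_eq: cA => ->; rewrite /up big_set0.
have kT' : (k.*2 <= #|T|)%N.
  by apply: leq_trans kT; rewrite leq_double.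
(* By the commutation relation [down f] has eigenvalue - (c + 1 + #|T| - 2k). *)
have df0 : forall B, #|B| = k -> down f B = 0.
  apply: (IH (c + (#|T| - k.*2))%N) => // B cB.
  have := down_up_comm (down f) B.
  rewrite (@eq_down _ (fun C => - c.+1%:R * f C)) ?downZ; last first.
    by move=> C cC; rewrite eig // cC cB.
  rewrite (cardC_layer kT' cB) cB natrD mulrDl [k%:R * _ + _]addrC addrA => /addIr e.
  by rewrite -addSn natrD opprD mulrDl e mulNr addrK.
apply: (@mul_natrS_eq0 c); apply/eqP; rewrite -oppr_eq0 -mulNr -eig //.
by rewrite /up big1 // => i iA; apply: df0; move: cA; rewrite (cardsD1 i) iA => -[].
Qed.

Lemma down_up_inj k f : (k.*2 < #|T|)%N ->
  (forall A, #|A| = k -> down (up f) A = 0) -> forall A, #|A| = k -> f A = 0.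
Proof.
move=> kT duf0; apply: (@up_down_neg_eigen k (#|T| - k.*2).-1) => [|A cA].
  exact: ltnW.
have := down_up_comm f A; rewrite duf0 // add0r.
rewrite (cardC_layer (ltnW kT) cA).
rewrite prednK ?subn_gt0 // cA natrD mulrDl [k%:R * _ + _]addrC addrA.
by rewrite -[LHS]add0r => /addIr /esym/eqP; rewrite addr_eq0 mulNr => /eqP.
Qed.

(** Complementation exchanges [up] and [down] and carries level k + 1 to level
    #|T| - (k + 1), which lies strictly below the middle.  *)
Lemma down_inj k f : (#|T| < k.+1.*2)%N ->
  (forall A, #|A| = k -> down f A = 0) -> forall A, #|A| = k.+1 -> f A = 0.
Proof.
move=> Tk df0 A cA.
have kT : (k.+1 <= #|T|)%N by rewrite -cA max_card.
pose fC B := f (~: B).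
have upC B : up fC B = down f (~: B).
  apply: eq_big => [i|i _]; first by rewrite inE negbK.
  by rewrite /fC setCD setUC.
rewrite -[A]setCK; apply: (@down_up_inj (#|T| - k.+1) fC).
- by rewrite doubleB ltn_subLR -?addnn ?leq_add // ltn_add2r addnn.
- move=> B cB; apply: big1 => i iB; rewrite upC; apply: df0.
  by rewrite cardsCs setCK cardsU1 iB cB add1n -subSn // subSS subKn // ltnW.
- by rewrite cardsCs setCK cA.
Qed.

(** * Reduction of the conditions to sets of size d *)

Definition shadow f A : K := \sum_(B : {set T} | A \subset B) f B.

(** Each superset B of A of size k contains #|B :\: A| = k - #|A| of the
    one-point extensions of A.  *)
Lemma shadow_down k f A : (forall B, #|B| != k -> f B = 0) ->
  (#|A| <= k)%N -> down (shadow f) A = (k - #|A|)%:R * shadow f A.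
Proof.
move=> f0 Ak; rewrite /down /shadow mulr_sumr.
rewrite (exchange_big_dep (fun B => A \subset B)) /=; last first.
  by move=> i B iA; rewrite subUset => /andP[].
apply: eq_bigr => B AB.
case: (boolP (#|B| == k)) => [/eqP cB|/f0 ->]; last first.
  by rewrite big1 ?mulr0 // => i.
have -> : (k - #|A|)%N = #|B :\: A| by rewrite cardsD (setIidPr AB) cB.
rewrite -sum1_card natr_sum mulr_suml; apply: eq_big => [i|i _]; last by rewrite mul1r.
by rewrite subUset AB andbT sub1set inE.
Qed.

Lemma shadow_top k f A : (forall B, #|B| != k -> f B = 0) ->
  #|A| = k -> shadow f A = f A.
Proof.
move=> f0 cA; rewrite /shadow (bigD1 A) //= big1 ?addr0 // => B /andP[AB nBA].
apply: f0; apply: contra nBA => /eqP cB.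
by rewrite eq_sym eqEcard AB cA cB leqnn.
Qed.

Lemma shadow_facet k f A : (forall B, #|B| != k.+1 -> f B = 0) ->
  #|A| = k -> shadow f A = down f A.
Proof.
move=> f0 cA; rewrite -[LHS]mul1r.
have -> : 1 = (k.+1 - #|A|)%:R :> K by rewrite cA subSn // subnn.
rewrite -shadow_down // ?cA ?leqnSn //.
by apply: eq_down => B cB; apply: (@shadow_top k.+1) => //; rewrite cB cA.
Qed.

(** Descending induction on the size of A: [shadow_down] recovers the value at
    A from the values at its one-point extensions.  *)
Lemma shadow_eq0 k f : (forall B, #|B| != k.+1 -> f B = 0) ->
  (forall A, #|A| = k -> down f A = 0) ->
  forall A, (#|A| <= k)%N -> shadow f A = 0.
Proof.
move=> f0 df0 A Ak; move cE: (k - #|A|)%N => m.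
elim: m A Ak cE => [|m IH] A Ak cE.
  have cA : #|A| = k by apply/eqP; rewrite eqn_leq Ak -subn_eq0 cE.
  by rewrite (@shadow_facet k) ?df0.
apply: (@mul_natrS_eq0 m.+1).
rewrite -cE -subSn // -shadow_down ?leqW // /down big1 // => i iA.
have ci : #|i |: A| = #|A|.+1 by rewrite cardsU1 iA.
by apply: IH; rewrite ci ?subnS ?cE // -subn_gt0 cE.
Qed.

End Boolean.

(** * Nonsingular simplices as sets *)

Section Translation.

Set Implicit Arguments.
Unset Strict Implicit.

Local Open Scope mset_scope.
Local Open Scope ring_scope.

Variables (K : fieldType) (n d : nat).
Implicit Types (A B : {set 'I_n}) (s S : {mset 'I_n}).

Definition mset_of_set A : {mset 'I_n} := seq_mset (enum A).
Definition set_of_mset s : {set 'I_n} := [set i | i \in s].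

Lemma mset_of_setE A i : mset_of_set A i = (i \in A).
Proof. by rewrite mset_seqE count_uniq_mem ?enum_uniq // mem_enum. Qed.

Lemma mset_of_setK : cancel mset_of_set set_of_mset.
Proof.
by move=> A; apply/setP => i; rewrite inE -mset_neq0 mset_of_setE eqb0 negbK.
Qed.

Lemma set_of_msetK s : (forall i, s i <= 1)%N -> mset_of_set (set_of_mset s) = s.
Proof.
move=> s1; apply/msetP => i; rewrite mset_of_setE inE -mset_neq0.
by case: (s i) (s1 i) => [|[]].
Qed.

Lemma size_mset_of_set A : size (mset_of_set A) = #|A|.
Proof. by rewrite (perm_size (perm_eq_seq_mset _)) -cardE. Qed.

Lemma mset_of_set_sub A B : (mset_of_set A `<=` mset_of_set B)%mset = (A \subset B).
Proof.
apply/msubsetP/subsetP => [AB i iA|AB i].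
  by have := AB i; rewrite !mset_of_setE iA; case: (i \in B).
by have := AB i; rewrite !mset_of_setE; case: (i \in A) => // ->.
Qed.

Lemma mem_complete_ns A : (mset_of_set A \in complete_ns n d) = (#|A| == d.+1).
Proof.
apply/complete_nsP/eqP => [[<- _]|cA]; first by rewrite size_mset_of_set.
by rewrite size_mset_of_set; split=> // i; rewrite mset_of_setE leq_b1.
Qed.

Lemma complete_ns_setK (s : complete_ns n d) : mset_of_set (set_of_mset (val s)) = val s.
Proof. by apply: set_of_msetK; have /complete_nsP[] := valP s. Qed.

Lemma card_complete_ns : #|{: complete_ns n d}| = 'C(n, d.+1).
Proof.
rewrite -cardfE -[n in RHS]card_ord -card_draws.
rewrite card_imfset /=; last exact: (can_inj mset_of_setK).
by rewrite -cardE; apply: eq_card => A; rewrite inE.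
Qed.

Lemma mset_mult1 S s : (S `<=` s)%mset -> (forall i, s i <= 1)%N ->
  mset_mult S s = 1%N.
Proof.
move=> /msubsetP Ss s1; rewrite /mset_mult big1 // => i _.
by move: (Ss i) (s1 i); case: (s i) => [|[]] //; case: (S i) => [|[]].
Qed.

Local Notation W := {ffun complete_ns n d -> K^o}.

(** Extension by zero to all subsets lets the operators of the Boolean lattice
    act on functions that live on a single level.  *)
Definition complex_ext (w : W) A : K :=
  oapp w 0 (insub (mset_of_set A) : option (complete_ns n d)).

Lemma complex_ext_set (w : W) (s : complete_ns n d) : complex_ext w (set_of_mset (val s)) = w s.
Proof. by rewrite /complex_ext complete_ns_setK valK. Qed.

Lemma complex_ext0 (w : W) B : #|B| != d.+1 -> complex_ext w B = 0.
Proof. by move=> cB; rewrite /complex_ext insubN // mem_complete_ns. Qed.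

Lemma balancing_sumE (w : W) A :
  \sum_(s : complete_ns n d | (mset_of_set A `<=` val s)%mset)
      w s * (mset_mult (mset_of_set A) (val s))%:R = shadow (complex_ext w) A.
Proof.
rewrite /shadow (bigID (fun B : {set 'I_n} => #|B| == d.+1)) /=.
rewrite [X in _ = _ + X]big1 ?addr0; last by move=> B /andP[_ /complex_ext0].
rewrite (reindex_omap (fun s : complete_ns n d => set_of_mset (val s))
          (fun B => insub (mset_of_set B))) /=; last first.
  move=> B /andP[_ cB]; rewrite insubT ?mem_complete_ns // => h /=.
  by rewrite mset_of_setK.
apply: eq_big => [s|s As].
  rewrite -mset_of_set_sub complete_ns_setK -mem_complete_ns complete_ns_setK.
  by rewrite (valP s) valK eqxx !andbT.
by rewrite complex_ext_set mset_mult1 ?mulr1 //; have /complete_nsP[] := valP s.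
Qed.

(** A multiset with a repeated point lies in no nonsingular simplex, so its
    condition is an empty sum; the others are sets, where [shadow_eq0] and
    [shadow_facet] apply.  *)
Lemma balancingP (w : W) (charK : [pchar K] =i pred0) :
  (forall A, #|A| = d -> down (complex_ext w) A = 0) <-> balancing d w.
Proof.
split=> [dw0 S Sd|bw A cA].
  case: (boolP [forall i, S i <= 1]%N) => [/forallP S1|].
    rewrite -(set_of_msetK S1) balancing_sumE.
    apply: (@shadow_eq0 K _ charK d) => //; first exact: complex_ext0.
    by rewrite -size_mset_of_set set_of_msetK.
  case/forallPn => i Si; rewrite big_pred0 // => s; apply/negP => /msubsetP Ss.
  have /complete_nsP[_ s1] := valP s.
  by move: Si; rewrite (leq_trans (Ss i)).
rewrite -(@shadow_facet K _ d) //; last exact: complex_ext0.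
by rewrite -balancing_sumE bw // size_mset_of_set cA.
Qed.

(** * The rank of the boundary map *)

Definition layer := {A : {set 'I_n} | #|A| == d}.
Local Notation F := {ffun layer -> K^o}.

Definition layer_ext (g : F) A : K := oapp g 0 (insub A : option layer).

Definition boundary (w : W) : F := [ffun A => down (complex_ext w) (val A)].
Definition coboundary (g : F) : W :=
  [ffun s => up (layer_ext g) (set_of_mset (val s))].

Fact boundary_linear : linear (boundary : W -> F).
Proof.
move=> a u v; apply/ffunP => A; rewrite !ffunE /down.
rewrite scaler_sumr -big_split; apply: eq_bigr => i _.
by rewrite /complex_ext; case: insub => [s|] /=; rewrite ?ffunE // scaler0 addr0.
Qed.

Fact coboundary_linear : linear coboundary.
Proof.
move=> a u v; apply/ffunP => A; rewrite !ffunE /up.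
rewrite scaler_sumr -big_split; apply: eq_bigr => i _.
by rewrite /layer_ext; case: insub => [s|] /=; rewrite ?ffunE // scaler0 addr0.
Qed.

HB.instance Definition _ := GRing.isLinear.Build K W F _ boundary boundary_linear.
HB.instance Definition _ := GRing.isLinear.Build K F W _ coboundary coboundary_linear.

Lemma card_layer : #|{: layer}| = 'C(n, d).
Proof.
by rewrite card_sig -[n in RHS]card_ord -card_draws; apply: eq_card => A; rewrite !inE.
Qed.

Lemma complex_ext_coboundary g A : #|A| = d.+1 -> complex_ext (coboundary g) A = up (layer_ext g) A.
Proof.
move=> /eqP; rewrite -mem_complete_ns => cA.
by rewrite -[A in LHS]mset_of_setK (@complex_ext_set _ [` cA]%fset) ffunE /= mset_of_setK.
Qed.

(** This is [down_up_inj] for finite functions; injectivity of the composite is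
    what yields surjectivity of [boundary].  *)
Lemma boundary_coboundary_inj (charK : [pchar K] =i pred0) g : (d.*2 < n)%N ->
  boundary (coboundary g) = 0 -> g = 0.
Proof.
move=> dn bc0; apply/ffunP => A; rewrite ffunE.
have -> : g A = layer_ext g (val A) by rewrite /layer_ext valK.
apply: (@down_up_inj K _ charK d); rewrite ?card_ord //; last exact: (eqP (valP A)).
move=> B /eqP cB; have := congr1 (fun h : F => h (Sub B cB)) bc0; rewrite !ffunE /= => <-.
by apply: eq_down => C cC; rewrite complex_ext_coboundary // cC (eqP cB).
Qed.

Lemma boundary_eq0P (w : W) :
  boundary w = 0 <-> forall A, #|A| = d -> down (complex_ext w) A = 0.
Proof.
split=> [bw0 A /eqP cA|dw0].
  by have := congr1 (fun h : F => h (Sub A cA)) bw0; rewrite !ffunE.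
by apply/ffunP => A; rewrite !ffunE dw0 //; exact: (eqP (valP A)).
Qed.

Lemma boundary_inj (charK : [pchar K] =i pred0) w : (n < d.+1.*2)%N ->
  boundary w = 0 -> w = 0.
Proof.
move=> nd /boundary_eq0P dw0; apply/ffunP => s; rewrite ffunE -complex_ext_set.
apply: (@down_inj K _ charK d); rewrite ?card_ord //.
by apply/eqP; rewrite -mem_complete_ns complete_ns_setK (valP s).
Qed.

Lemma dim_ffun_regular (I : finType) : \dim {: {ffun I -> K^o}} = #|I|.
Proof. by rewrite dimvf /dim /= muln1. Qed.

End Translation.

Theorem proposition5p5 (K : fieldType) (charK : [pchar K] =i pred0)
    (n d : nat) (n_ge1 : (1 <= n)%N) :
  exists V : {vspace {ffun complete_ns n d -> K^o}},
    (forall w : {ffun complete_ns n d -> K^o}, w \in V <-> balancing d w) /\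
    (\dim V)%:Z = Num.max (('C(n, d.+1))%:Z - ('C(n, d))%:Z) 0.
Proof.
pose bd := linfun (@boundary K n d); pose cb := linfun (@coboundary K n d).
exists (lker bd); split=> [w|].
  rewrite memv_ker lfunE /= -(balancingP w charK) -boundary_eq0P.
  by split=> [/eqP|->].
have rank_nullity : (\dim (lker bd) + \dim (limg bd) = 'C(n, d.+1))%N.
  by rewrite -card_complete_ns -(@dim_ffun_regular K) -(limg_ker_dim bd fullv) capfv.
have rank_le : (\dim (limg bd) <= 'C(n, d))%N.
  by rewrite -(@card_layer n d) -(@dim_ffun_regular K) dimvS // subvf.
case: (ltnP d.*2 n) => dn.
  have inj : lker (bd \o cb)%VF == 0%VS.
    apply/lker0P => u v; rewrite !comp_lfunE !lfunE /= => e.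
    apply/eqP; rewrite -subr_eq0; apply/eqP.
    by apply: (boundary_coboundary_inj charK) => //; rewrite !linearB /= e subrr.
  have rank_ge : ('C(n, d) <= \dim (limg bd))%N.
    rewrite -(@card_layer n d) -(@dim_ffun_regular K).
    rewrite -[leqLHS](limg_dim_eq (f := (bd \o cb)%VF)) ?(eqP inj) ?capv0 //.
    by rewrite limg_comp; apply: dimvS; apply: limgS; apply: subvf.
  (* The difference is nonnegative because it is the dimension of a kernel. *)
  have rk : \dim (limg bd) = 'C(n, d) by apply/eqP; rewrite eqn_leq rank_le.
  by rewrite -rank_nullity rk PoszD addrK; apply/esym/max_idPl.
have k0 : lker bd = 0%VS.
  apply/eqP/lker0P => u v; rewrite !lfunE /= => e.
  apply/eqP; rewrite -subr_eq0; apply/eqP.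
  apply: (boundary_inj charK); last by rewrite linearB /= e subrr.
  by rewrite doubleS ltnS leqW.
(* Injectivity itself gives C(n, d+1) <= C(n, d), so the maximum is 0. *)
move: rank_nullity; rewrite k0 dimv0 add0n => <-.
by apply/esym/max_idPr; rewrite subr_le0 lez_nat.
Qed.
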